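(* Let $N\ge 1$, let $\mathcal{X}\in\mathbb{R}^{I_1\times\cdots\times I_N}$ be a tensor with set of observable entries $\Omega$, let $\lambda>0$, and let $\mathcal{G}\in\mathbb{R}^{J_1\times\cdots\times J_N}$ and $\mathbf{A}^{(k)}\in\mathbb{R}^{I_k\times J_k}$ ($k=1,\dots,N$). Define $$L_F(\mathcal{G},\mathbf{A}^{(1)},\dots,\mathbf{A}^{(N)})=\sum_{\alpha=(i_1,\dots,i_N)\in\Omega}\Big(\mathcal{X}_\alpha-\sum_{\beta=(j_1,\dots,j_N)}\mathcal{G}_\beta\prod_{k=1}^N a^{(k)}_{i_kj_k}\Big)^2+\lambda\Big(\|\mathcal{G}\|_F^2+\sum_{k=1}^N\|\mathbf{A}^{(k)}\|_F^2\Big).$$ Fix a mode $n$ and indices $1\le i_n\le I_n$, $1\le j_n\le J_n$. Regard $L_F$ as a function of the single real variable $a^{(n)}_{i_nj_n}$, all other entries of $\mathcal{G},\mathbf{A}^{(1)},\dots,\mathbf{A}^{(N)}$ being held fixed. Then $$\operatorname*{arg\,min}_{a^{(n)}_{i_nj_n}}L_F(\mathcal{G},\mathbf{A}^{(1)},\dots,\mathbf{A}^{(N)})=\frac{\Big(\sum_{\alpha\in\Omega^{(n)}_{i_n}}\mathcal{X}_\alpha\,\delta^{(n)}_\alpha(j_n)\Big)-\Big(\sum_{t\ne j_n}v^{(n)}_{i_nj_n}(t)\,a^{(n)}_{i_nt}\Big)}{v^{(n)}_{i_nj_n}(j_n)+\lambda},$$ where $t$ ranges over $\{1,\dots,J_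n\}\setminus\{j_n\}$.
   Context: $\Omega\subseteq\{1,\dots,I_1\}\times\cdots\times\{1,\dots,I_N\}$ is the set of indices of observed entries of $\mathcal{X}$; $\Omega^{(n)}_{i_n}$ is the subset of $\Omega$ consisting of the multi-indices whose $n$-th component equals $i_n$. $a^{(k)}_{ij}$ denotes the $(i,j)$ entry of $\mathbf{A}^{(k)}$. $\|\cdot\|_F$ is the Frobenius norm (square root of the sum of squares of the entries). $\beta=(j_1,\dots,j_N)$ ranges over all indices of $\mathcal{G}$. For $\alpha=(i_1,\dots,i_N)\in\Omega$ and $1\le j\le J_n$, $$\delta^{(n)}_\alpha(j)=\sum_{\beta=(j_1,\dots,j_N):\,j_n=j}\mathcal{G}_\beta\prod_{k\ne n}a^{(k)}_{i_kj_k},$$ the sum being over all core-tensor indices whose $n$-th component is $j$. For $1\le j\le J_n$, $$v^{(n)}_{i_nj_n}(j)=\sum_{\alpha\in\Omega^{(n)}_{i_n}}\delta^{(n)}_\alpha(j)\,\delta^{(n)}_\alpha(j_n).$$ *)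

(* Defs.v *)
From HB Require Import structures.
From mathcomp Require Import all_boot all_order all_algebra.
From mathcomp Require Import classical_sets reals.

Set Implicit Arguments.
Unset Strict Implicit.
Unset Printing Implicit Defensive.

Import Order.TTheory GRing.Theory Num.Theory.
Local Open Scope ring_scope.

(* Modes and indices are numbered from 0. *)
Definition tindex (N : nat) (d : 'I_N -> nat) : finType :=
  {dffun forall k : 'I_N, 'I_(d k)}.

Definition tensor (R : Type) (N : nat) (d : 'I_N -> nat) : Type :=
  {ffun tindex d -> R}.

Definition factors (R : Type) (N : nat) (I J : 'I_N -> nat) : Type :=
  forall k : 'I_N, 'M[R]_(I k, J k).

Definition tensor_fnorm (R : realType) (N : nat) (d : 'I_N -> nat)
    (G : tensor R d) : R :=
  Num.sqrt (\sum_(beta : tindex d) G beta ^+ 2).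

Definition matrix_fnorm (R : realType) (p q : nat) (M : 'M[R]_(p, q)) : R :=
  Num.sqrt (\sum_(i < p) \sum_(j < q) M i j ^+ 2).

Definition loss (R : realType) (N : nat) (I J : 'I_N -> nat)
    (X : tensor R I) (Omega : {set tindex I}) (lambda : R)
    (G : tensor R J) (A : factors R I J) : R :=
  \sum_(alpha in Omega)
     (X alpha - \sum_(beta : tindex J)
                   G beta * \prod_(k < N) A k (alpha k) (beta k)) ^+ 2
  + lambda * (tensor_fnorm G ^+ 2 + \sum_(k < N) matrix_fnorm (A k) ^+ 2).

Definition slice (N : nat) (I : 'I_N -> nat) (Omega : {set tindex I})
    (n : 'I_N) (i : 'I_(I n)) : {set tindex I} :=
  [set alpha in Omega | alpha n == i]%SET.

Definition delta (R : realType) (N : nat) (I J : 'I_N -> nat)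
    (G : tensor R J) (A : factors R I J) (n : 'I_N)
    (alpha : tindex I) (j : 'I_(J n)) : R :=
  \sum_(beta : tindex J | beta n == j)
     G beta * \prod_(k < N | k != n) A k (alpha k) (beta k).

(* [vcoef Omega G A i j t] is $v^{(n)}_{ij}(t)$. *)
Definition vcoef (R : realType) (N : nat) (I J : 'I_N -> nat)
    (Omega : {set tindex I}) (G : tensor R J) (A : factors R I J) (n : 'I_N)
    (i : 'I_(I n)) (j t : 'I_(J n)) : R :=
  \sum_(alpha in slice Omega i) delta G A alpha t * delta G A alpha j.

(* The family A with entry (i, j) of its n-th matrix replaced by x;
   [dfwith] changes only the n-th member of a dependent family. *)
Definition set_entry (R : realType) (N : nat) (I J : 'I_N -> nat)
    (A : factors R I J) (n : 'I_N) (i : 'I_(I n)) (j : 'I_(J n)) (x : R) :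
    factors R I J :=
  dfwith A (\matrix_(p < I n, q < J n)
              if (p == i) && (q == j) then x else A n p q).

Definition argmin (R : realType) (T : Type) (f : T -> R) : set T :=
  [set x | forall y, f x <= f y]%classic.

(* Main.v *)
(** As a function of one entry [x] of the [n]-th factor matrix, the model value
    at [alpha] is affine in [x] with slope [delta G A alpha j] when
    [alpha n = i], and constant otherwise. So the loss is a quadratic polynomial
    in [x] with leading coefficient [vcoef Omega G A i j j + lambda > 0], and its
    minimum is found by completing the square. *)

Require Import Defs.
From HB Require Import structures.
From mathcomp Require Import all_boot all_order all_algebra.
From mathcomp Require Import classical_sets reals.
From mathcomp Require Import ring.

Set Implicit Arguments.
Unset Strict Implicit.
Unset Printing Implicit Defensive.

Import Order.TTheory GRing.Theory Num.Theory.
Local Open Scope ring_scope.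

Lemma argmin_quadratic (R : realType) (f : R -> R) (a b c : R) :
    0 < a -> (forall x, f x = a * x ^+ 2 - 2 * b * x + c) ->
  argmin f = [set b / a]%classic.
Proof.
move=> a_gt0 fE.
(* Completing the square, with [c] absorbed into the value at the vertex [b / a]. *)
have f_sqr x : f x = f (b / a) + a * (x - b / a) ^+ 2.
  by rewrite !fE; field; rewrite gt_eqF.
apply/seteqP; split => x; rewrite /argmin /=.
  (* A minimiser, tested against the vertex, has [a * (x - b / a) ^+ 2 <= 0], so it is the
     vertex. *)
  move=> /(_ (b / a)); rewrite [f x]f_sqr gerDl pmulr_rle0 // => sq_le0.
  by apply/eqP; rewrite -subr_eq0 -sqrf_eq0 eq_le sq_le0 sqr_ge0.
by move=> -> y; rewrite [f y]f_sqr lerDl mulr_ge0 ?sqr_ge0 // ltW.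
Qed.

Section SetEntry.
Variables (R : realType) (N : nat) (I J : 'I_N -> nat).
Variables (G : tensor R J) (A : factors R I J).
Variables (n : 'I_N) (i : 'I_(I n)) (j : 'I_(J n)).

Lemma set_entry_eq x p q :
  set_entry A i j x n p q = if (p == i) && (q == j) then x else A n p q.
Proof. by rewrite /set_entry dfwith_in mxE. Qed.

Lemma set_entry_neq x k : k != n -> set_entry A i j x k = A k.
Proof. by move=> nk; rewrite /set_entry dfwith_out // eq_sym. Qed.

(** The product in [delta] omits mode [n], the only mode whose matrix is modified. *)
Lemma delta_set_entry x alpha (t : 'I_(J n)) :
  delta G (set_entry A i j x) alpha t = delta G A alpha t.
Proof.
apply: eq_bigr => beta _; congr (_ * _).
by apply: eq_bigr => k kn; rewrite set_entry_neq.
Qed.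

(** Group the core indices by their [n]-th component [t]: on each group the mode-[n] factor is the
    constant [B n (alpha n) t] and pulls out. This exhibits the model value as linear in row
    [alpha n] of [B n]. *)
Lemma model_delta (B : factors R I J) (alpha : tindex I) :
  \sum_(beta : tindex J) G beta * \prod_(k < N) B k (alpha k) (beta k) =
  \sum_(t < J n) delta G B alpha t * B n (alpha n) t.
Proof.
rewrite (partition_big (fun beta : tindex J => beta n) xpredT) //=.
apply: eq_bigr => t _; rewrite big_distrl /=.
apply: eq_bigr => beta /eqP <-.
by rewrite (bigD1 n) //= mulrCA [RHS]mulrC.
Qed.

Lemma model_set_entry_in x (alpha : tindex I) : alpha n = i ->
  \sum_(beta : tindex J)
    G beta * \prod_(k < N) set_entry A i j x k (alpha k) (beta k) =
  delta G A alpha j * x + \sum_(t < J n | t != j) delta G A alpha t * A n i t.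
Proof.
move=> alphan; rewrite model_delta (bigD1 j) //= delta_set_entry.
rewrite set_entry_eq alphan !eqxx /=; congr (_ + _).
by apply: eq_bigr => t /negPf tj; rewrite delta_set_entry set_entry_eq tj andbF.
Qed.

Lemma model_set_entry_out x (alpha : tindex I) : alpha n != i ->
  \sum_(beta : tindex J)
    G beta * \prod_(k < N) set_entry A i j x k (alpha k) (beta k) =
  \sum_(beta : tindex J) G beta * \prod_(k < N) A k (alpha k) (beta k).
Proof.
move=> /negPf alphan; rewrite !model_delta; apply: eq_bigr => t _.
by rewrite delta_set_entry set_entry_eq alphan.
Qed.

Lemma matrix_fnorm_sqr p q (M : 'M[R]_(p, q)) :
  matrix_fnorm M ^+ 2 = \sum_(r < p) \sum_(s < q) M r s ^+ 2.
Proof.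
by rewrite sqr_sqrtr // !sumr_ge0 // => r _; apply: sumr_ge0 => s _; apply: sqr_ge0.
Qed.

Lemma factors_fnorm_set_entry x :
  \sum_(k < N) matrix_fnorm (set_entry A i j x k) ^+ 2 =
  x ^+ 2 + (\sum_(k < N) matrix_fnorm (A k) ^+ 2 - A n i j ^+ 2).
Proof.
rewrite (bigD1 n) //= [in RHS](bigD1 n) //=.
under eq_bigr => k kn do rewrite set_entry_neq //.
(* The norms of the other modes cancel, leaving an identity about the [n]-th matrix alone. *)
rewrite [RHS]addrA addrAC !addrA; congr (_ + _).
rewrite !matrix_fnorm_sqr !pair_big /= (bigD1 (i, j)) //=.
rewrite [in RHS](bigD1 (i, j)) //= set_entry_eq !eqxx /=.
under eq_bigr => pq pqij.
  (* Equality of pairs unfolds to the componentwise test in [set_entry], so [pqij] selects the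
     unmodified entry. *)
  rewrite set_entry_eq -[_ && _]/(pq == (i, j)) (negPf pqij); over.
by ring.
Qed.

(** The constant term stays existential because it does not affect the minimiser; the shape is the
    one [argmin_quadratic] expects. *)
Lemma loss_set_entry (X : tensor R I) (Omega : {set tindex I}) (lambda : R) :
  exists c, forall x, loss X Omega lambda G (set_entry A i j x) =
    (vcoef Omega G A i j j + lambda) * x ^+ 2
    - 2 * (\sum_(alpha in slice Omega i) X alpha * delta G A alpha j
           - \sum_(t < J n | t != j) vcoef Omega G A i j t * A n i t) * x + c.
Proof.
(* For [alpha] in the slice, [rest alpha] is the part of the model value free of [x]. *)
pose rest (alpha : tindex I) := \sum_(t < J n | t != j) delta G A alpha t * A n i t.
have restE : \sum_(t < J n | t != j) vcoef Omega G A i j t * A n i t =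
    \sum_(alpha in slice Omega i) rest alpha * delta G A alpha j.
  under eq_bigr do rewrite big_distrl /=.
  rewrite exchange_big /=; apply: eq_bigr => alpha _; rewrite big_distrl /=.
  by apply: eq_bigr => t _; rewrite mulrAC.
have sliceE (alpha : tindex I) :
    (alpha \in slice Omega i) = (alpha \in Omega) && (alpha n == i).
  by rewrite inE.
pose model (alpha : tindex I) :=
  \sum_(beta : tindex J) G beta * \prod_(k < N) A k (alpha k) (beta k).
(* The terms free of [x]: the constant part of the squares on the slice, all squares off it, and the
   penalty without [lambda * x ^+ 2]. *)
exists (\sum_(alpha in slice Omega i) (X alpha - rest alpha) ^+ 2
  + \sum_(alpha in Omega | alpha n != i) (X alpha - model alpha) ^+ 2
  + lambda * (tensor_fnorm G ^+ 2
      + (\sum_(k < N) matrix_fnorm (A k) ^+ 2 - A n i j ^+ 2))) => x.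
rewrite /loss factors_fnorm_set_entry (bigID (fun alpha : tindex I => alpha n == i)) /=.
have -> : \sum_(alpha in Omega | alpha n != i) (X alpha -
      \sum_(beta : tindex J)
        G beta * \prod_(k < N) set_entry A i j x k (alpha k) (beta k)) ^+ 2 =
    \sum_(alpha in Omega | alpha n != i) (X alpha - model alpha) ^+ 2.
  by apply: eq_bigr => alpha /andP[_ alphan]; rewrite model_set_entry_out.
(* On the slice the residual is [X alpha - rest alpha - delta G A alpha j * x]; its square is
   expanded in powers of [x] and summed. *)
have -> : \sum_(alpha in Omega | alpha n == i) (X alpha -
      \sum_(beta : tindex J)
        G beta * \prod_(k < N) set_entry A i j x k (alpha k) (beta k)) ^+ 2 =
    vcoef Omega G A i j j * x ^+ 2
    - 2 * (\sum_(alpha in slice Omega i) X alpha * delta G A alpha j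
           - \sum_(alpha in slice Omega i) rest alpha * delta G A alpha j) * x
    + \sum_(alpha in slice Omega i) (X alpha - rest alpha) ^+ 2.
  rewrite -sumrB mulr_sumr /vcoef !mulr_suml -sumrB -big_split /=.
  rewrite -(eq_bigl _ _ sliceE); apply: eq_bigr => alpha.
  rewrite sliceE => /andP[_ /eqP alphan].
  by rewrite model_set_entry_in // -/(rest alpha); ring.
by rewrite restE; ring.
Qed.

End SetEntry.

Theorem lemma1 (R : realType) (N : nat) (hN : (1 <= N)%N)
    (I J : 'I_N -> nat)
    (X : tensor R I) (Omega : {set tindex I})
    (lambda : R) (hlambda : 0 < lambda)
    (G : tensor R J) (A : factors R I J)
    (n : 'I_N) (i : 'I_(I n)) (j : 'I_(J n)) :
  argmin (fun x : R => loss X Omega lambda G (set_entry A i j x)) =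
  [set (\sum_(alpha in slice Omega i) X alpha * delta G A alpha j
        - \sum_(t < J n | t != j) vcoef Omega G A i j t * A n i t)
       / (vcoef Omega G A i j j + lambda)]%classic.
Proof.
have [c lossE] := loss_set_entry G A i j X Omega lambda.
(* The leading coefficient is positive: [vcoef Omega G A i j j] is a sum of squares, and [lambda] is
   positive. *)
apply: argmin_quadratic lossE; rewrite ltr_wpDl //.
by apply: sumr_ge0 => alpha _; rewrite -expr2 sqr_ge0.
Qed.
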